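(* Let $n\ge 1$ be an integer and let $X$ be an $S(n)$-space. Then $X$ is $S(n)$-$\theta$-closed if and only if every infinite set $A\subseteq X$ $\theta^0(n)$-converges to the set $B$ of all its $\theta^0(n)$-complete accumulation points.
   Context: All neighborhoods are open; $\overline{M}=\mathrm{cl}\,M$ is the closure in the space $X$. $\theta^n$-closure: $\mathrm{cl}_{\theta^0}M=\mathrm{cl}\,M$; for $n\ge 1$, $x\notin \mathrm{cl}_{\theta^n}M$ iff there are open neighborhoods $U_1,\dots,U_n$ of $x$ with $\mathrm{cl}\,U_i\subseteq U_{i+1}$ for $i=1,\dots,n-1$ and $\mathrm{cl}\,U_n\cap M=\emptyset$. For $n=1$ write $\mathrm{cl}_\theta=\mathrm{cl}_{\theta^1}$; $M$ is $\theta$-closed if $M=\mathrm{cl}_\theta M$. The $\theta^n$-interior is $\mathrm{Int}_{\theta^n}M=X\setminus \mathrm{cl}_{\theta^n}(X\setminus M)$. For $n\ge1$, $X$ is an $S(n)$-space if $x\notin\mathrm{cl}_{\theta^n}\{y\}$ for any two distinct points $x,y\in X$. An $S(n)$-space is $S(n)$-$\theta$-closed if it is $\theta$-closed in every $S(n)$-space containing it as a subspace. An $n$-hull of a point $x$ is a neighborhood $U$ of $x$ for which there are neighborhoods $U_1,\dots,U_n=U$ of $x$ with $\mathrm{cl}\,U_i\subseteq U_{i+1}$ for $i=1,\dots,n-1$. A point $x$ is a $\theta^0(n)$-complete accumulation point of an infinite set $F$ if $|F\cap U|=|F|$ for every $n$-hull $U$ of $x$. For $k\ge 0$, an $S(k)$-cover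 of a subset $B\subseteq X$ is a family $\{U_\alpha\}$ of open subsets of $X$ such that $B\subseteq\bigcup_\alpha \mathrm{Int}_{\theta^k}U_\alpha$. A set $A$ $\theta^0(n)$-converges to a set $B$ if for every $S(n-1)$-cover $\gamma$ of $B$ there is a finite family $\{U_{\alpha_i}\}_{i=1}^k\subseteq\gamma$ such that $|A\setminus \bigcup_{i=1}^k U_{\alpha_i}|<|A|$. *)

(* Defs.v *)
From HB Require Import structures.
From mathcomp Require Import all_boot all_order.
From mathcomp Require Import boolp classical_sets functions cardinality.
From mathcomp Require Import topology.

Set Implicit Arguments.
Unset Strict Implicit.
Unset Printing Implicit Defensive.

Local Open Scope classical_set_scope.
Local Open Scope card_scope.

Notation "A #< B" := ((A #<= B) && ~~ (B #<= A))%card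
  (at level 79) : card_scope.

Section ThetaClosure.
Context {X : topologicalType}.
Implicit Types (x : X) (M U : set X).

(* Only U 1, ..., U n matter; the other values of U are junk. *)
Definition nbhs_chain (n : nat) x (U : nat -> set X) : Prop :=
  (forall i : nat, (1 <= i <= n)%N -> open_nbhs x (U i)) /\
  (forall i : nat, (1 <= i < n)%N -> closure (U i) `<=` U i.+1).

Definition theta_closure (n : nat) M : set X :=
  if n is 0 then closure M
  else [set x | ~ exists U : nat -> set X,
                    nbhs_chain n x U /\ closure (U n) `&` M = set0].

Definition theta_interior (n : nat) M : set X :=
  ~` theta_closure n (~` M).

Definition theta_closed M : Prop := M = theta_closure 1 M.

Definition hull (n : nat) x U : Prop :=
  open_nbhs x U /\ exists V : nat -> set X, nbhs_chain n x V /\ V n = U.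

Definition complete_accumulation_points (n : nat) (F : set X) : set X :=
  [set x | forall U, hull n x U -> F `&` U #= F].

Definition S_cover (k : nat) (B : set X) (gamma : set (set X)) : Prop :=
  (forall U, gamma U -> open U) /\
  B `<=` \bigcup_(U in gamma) theta_interior k U.

(* The finite subfamily delta may be empty; this only matters when gamma
   itself is empty. *)
Definition theta_converges (n : nat) (A B : set X) : Prop :=
  forall gamma : set (set X), S_cover n.-1 B gamma ->
    exists delta : set (set X),
      [/\ finite_set delta, delta `<=` gamma
        & A `\` \bigcup_(U in delta) U #< A].

End ThetaClosure.

(* Used only for 0 < n. *)
Definition S_space (n : nat) (X : topologicalType) : Prop :=
  forall x y : X, x <> y -> ~ theta_closure n [set y] x.

Definition topological_embedding (X Y : topologicalType) (f : X -> Y) : Prop :=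
  injective f /\
  (forall U : set X, open U <-> exists V : set Y, open V /\ f @^-1` V = U).

(* "Y contains X as a subspace" is rendered by an embedding of X into Y. *)
Definition S_theta_closed (n : nat) (X : topologicalType) : Prop :=
  S_space n X /\
  forall (Y : topologicalType) (f : X -> Y),
    S_space n Y -> topological_embedding f -> theta_closed (range f).

(* Main.v *)
(** Unfolding the definitions, an [S(n-1)]-cover of [B] is a family of open sets
    in which every point of [B] has an [n]-hull. Both sides of the equivalence
    say that every [S(n-1)]-cover of the whole space has a finite subcover.

    If such a cover [gamma] has no finite subcover, attach to each point of [X]
    a sequence of isolated points converging to it and add one point whose
    neighborhoods contain almost all isolated points above the complement of a
    finite union of members of [gamma]. The result is an [S(n)]-space in which
    the new point lies in the [theta]-closure of [X]. Conversely, for a point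
    outside [X] the hulls separating the points of [X] from it form an
    [S(n-1)]-cover, and a finite subcover yields a neighborhood whose closure
    misses [X].

    Given finite subcovers, add to an [S(n-1)]-cover of the set of complete
    accumulation points of [A] all open [U] with [|A /\ U| < |A|]; a finite
    subcover of the enlarged family works because an infinite set is not a
    finite union of sets of smaller cardinality. Conversely, a set of least
    cardinality that is not finitely covered by [gamma] is infinite, and
    convergence covers all of it but a strictly smaller part, a contradiction. *)

Require Import Defs.
From HB Require Import structures.
From mathcomp Require Import all_boot all_order.
From mathcomp Require Import boolp classical_sets functions cardinality.
From mathcomp Require Import topology.

Local Open Scope classical_set_scope.
Local Open Scope card_scope.

(** * Cardinals *)

(* A maximal set of choice functions with values pairwise distinct at every
   member of [F] must exhaust some [A] in [F] by its values at [A]. *)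
Lemma card_min {T : Type} {F : set (set T)} :
  F !=set0 -> exists2 A, F A & forall B, F B -> A #<= B.
Proof.
move=> [A0 FA0].
pose P (D : set (set T -> T)) :=
  (forall f A, D f -> F A -> A (f A)) /\
  (forall f g A, D f -> D g -> F A -> f A = g A -> f = g).
have [|D [[DP Dinj] Dmax]] := @Zorn_bigcup _ P.
  move=> G GP Gtot; split=> [f A [D GD Df]|f g A [D GD Df] [E GE Eg]].
    exact: (GP _ GD).1.
  have [DE|ED] := Gtot _ _ GD GE.
    exact: (GP _ GE).2 _ _ _ (DE _ Df) Eg.
  exact: (GP _ GD).2 _ _ _ Df (ED _ Eg).
have [A FA AD] : exists2 A, F A & A `<=` (fun f => f A) @` D.
  apply: contrapT => noA.
  (* Outside [F] the value is arbitrary, so [choice] gives one total [h] that differs from every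
     member of [D] throughout [F]. *)
  have out A : exists x, F A -> A x /\ forall f, D f -> f A <> x.
    have ex B : F B -> exists x, B x /\ forall f, D f -> f B <> x.
      move=> FB; apply: contrapT => nx; apply: noA; exists B => // x Bx.
      apply: contrapT => Dx; apply: nx; exists x; split=> // f Df fBx.
      by apply: Dx; exists f.
    have [FA|nFA] := pselect (F A); first by have [x] := ex _ FA; exists x.
    by have [x _] := ex _ FA0; exists x.
  have [h hP] := choice out.
  case: (Dmax (h |` D)).
    split=> [|/(_ h (or_introl erefl)) Dh]; first exact: subsetUr.
    exact: (hP _ FA0).2 Dh erefl.
  split=> [f A [->|Df] FA|f g A [->|Df] [->|Dg] FA //].
  - exact: (hP _ FA).1.
  - exact: (DP _ _ Df FA).
  - by move=> /esym; case: (hP _ FA) => _ /(_ _ Dg).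
  - by case: (hP _ FA) => _ /(_ _ Df).
  - exact: Dinj.
exists A => // B FB.
(* [D] is equipotent with its values at any member of [F], so [A] injects into [D] and [D] into
   [B]. *)
have inj C : F C -> (fun f => f C) @` D #= D.
  by move=> FC; apply: inj_card_eq => f g /set_mem Df /set_mem Dg; exact: Dinj.
apply: card_le_trans (subset_card_le AD) _.
rewrite (card_le_eql (inj _ FA)) -(card_le_eql (inj _ FB)).
by apply: subset_card_le => _ [f Df <-]; exact: (DP _ _ Df FB).
Qed.

Lemma card_le_total (T : Type) (A B : set T) : A #<= B \/ B #<= A.
Proof.
have [|C [->|->] min] := card_min (F := [set A; B]); first by exists A; left.
  by left; apply: min; right.
by right; apply: min; left.
Qed.

(* Zorn splits [Q] into disjoint injective sequences and a finite remainder,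
   which is absorbed by one of the sequences. *)
Lemma infinite_set_double {T : Type} {Q : set T} : infinite_set Q ->
  exists h : bool -> T -> T, (forall b x, Q x -> Q (h b x)) /\
    (forall b c x y, Q x -> Q y -> h b x = h c y -> b = c /\ x = y).
Proof.
move=> Qinf.
pose P (D : set (nat -> T)) :=
  (forall s m, D s -> Q (s m)) /\
  (forall s t m n, D s -> D t -> s m = t n -> s = t /\ m = n).
have [|D [[DQ Dinj] Dmax]] := @Zorn_bigcup _ P.
  move=> G GP Gtot; split=> [s m [D GD Ds]|s t m n [D GD Ds] [E GE Et]].
    exact: (GP _ GD).1.
  have [DE|ED] := Gtot _ _ GD GE.
    exact: (GP _ GE).2 _ _ _ _ (DE _ Ds) Et.
  exact: (GP _ GD).2 _ _ _ _ Ds (ED _ Et).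
have [q0 Qq0] := infinite_setN0 Qinf.
pose R := [set q | Q q /\ forall s m, D s -> s m <> q].
have Rfin : finite_set R.
  apply: contrapT => /infiniteP;
  elim/Ppointed: T => T in Q Qinf P D DQ Dinj Dmax q0 Qq0 R *.
    by case: (T q0).
  move=> /pcard_leP[u].
  have uR m : R (u m) by exact: funS.
  have uinj m n : u m = u n -> m = n by apply: (inj (f := u)); rewrite inE.
  case: (Dmax ((u : nat -> T) |` D)).
    split=> [|/(_ _ (or_introl erefl)) Du]; first exact: subsetUr.
    exact: (uR 0).2 Du erefl.
  split=> [s m [->|Ds]|s t m n [->|Ds] [->|Dt] //].
  - exact: (uR m).1.
  - exact: DQ.
  - by move=> /uinj.
  - by move=> /esym /(uR m).2; case/(_ Dt).
  - by move=> /(uR n).2; case/(_ Ds).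
  - exact: Dinj.
have [s0 Ds0] : exists s, D s.
  apply: contrapT => D0; apply: Qinf; apply: sub_finite_set Rfin => q Qq.
  by split=> // s m Ds; case: D0; exists s.
have /countable_injP[e einj] := finite_set_countable Rfin.
(* A term [s m] gets the odd index [m.*2.+1] in [s]; the remainder [R] gets even indices in the
   single sequence [s0]. *)
have code q : exists k : (nat -> T) * nat, Q q -> D k.1 /\
    ((odd k.2 /\ k.1 k.2./2 = q) \/ (R q /\ k = (s0, (e q).*2))).
  have [Rq|nRq] := pselect (R q).
    by exists (s0, (e q).*2) => _; split=> //; right.
  have [Qq|nQq] := pselect (Q q); last by exists (s0, 0).
  have [s [m [Ds smq]]] : exists s m, D s /\ s m = q.
    apply: contrapT => nsm; apply: nRq; split=> // s m Ds smq.
    by apply: nsm; exists s, m.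
  exists (s, m.*2.+1) => _; split=> //; left => /=.
  by rewrite odd_double uphalf_double.
have [k kP] := choice code.
(* Doubling the index leaves the lowest bit free for [b]. *)
exists (fun b q => (k q).1 ((k q).2.*2 + b)); split=> [b q Qq|b c x y Qx Qy].
  by apply: DQ; have [] := kP _ Qq.
have [Dx kx] := kP _ Qx; have [Dy ky] := kP _ Qy.
move=> /(Dinj _ _ _ _ Dx Dy)[k1 kbc].
have bc : b = c.
  by move: (congr1 odd kbc); rewrite !oddD !odd_double; case: (b); case: (c).
have k2 : (k x).2 = (k y).2.
  by move: kbc; rewrite bc => /addIn /double_inj.
split=> //.
case: kx ky => [[ox kx]|[Rx kx]] [[oy ky]|[Ry ky]].
- by rewrite -kx -ky k1 k2.
- by move: ox; rewrite k2 ky /= odd_double.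
- by move: oy; rewrite -k2 kx /= odd_double.
- by move: k2; rewrite kx ky /= => /double_inj; apply: einj; exact: mem_set.
Qed.

(** If [P] is the smaller set, the two disjoint copies of [Q] inside [Q] have room for [Q] and for
    the rest of [P]. *)
Lemma infinite_setU_card_le {T : Type} {P Q : set T} :
  infinite_set (P `|` Q) -> P `|` Q #<= P \/ P `|` Q #<= Q.
Proof.
wlog PQ : P Q / P #<= Q.
  move=> wl; have [/wl//|QP] := card_le_total _ P Q.
  by rewrite setUC => /(wl _ _ QP)[]; [right|left].
rewrite finite_setU => PQinf; right.
have Qinf : infinite_set Q.
  by move=> Qfin; apply: PQinf; split=> //; exact: card_le_finite PQ Qfin.
have [h [hQ hinj]] := infinite_set_double Qinf.
have [i [iQ iinj]] : exists i : T -> T, (forall x, P x -> Q (i x)) /\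
    (forall x y, P x -> P y -> i x = i y -> x = y).
  elim/Ppointed: T => T in P Q PQ PQinf Qinf h hQ hinj *.
    by case: (infinite_setN0 Qinf) => q; case: (T q).
  move/pcard_leP: PQ => [i]; exists i; split=> [x Px|x y Px Py].
    exact: funS.
  by apply: (inj (f := i)); rewrite inE.
pose f x := if pselect (Q x) then h true x else h false (i x).
have ffun : set_fun (P `|` Q) Q f.
  move=> x PQx; rewrite /f; case: pselect => [Qx|nQx]; first exact: hQ.
  by apply: hQ; apply: iQ; case: PQx.
have finj : set_inj (P `|` Q) f.
  move=> x y /set_mem PQx /set_mem PQy; rewrite /f.
  case: pselect => [Qx|nQx]; case: pselect => [Qy|nQy].
  - by move=> /hinj[].
  - case: PQy => // Py.
    by case/hinj => //; exact: iQ.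
  - case: PQx => // Px.
    by case/hinj => //; exact: iQ.
  - case: PQx PQy => // Px [] // Py.
    by case/hinj => [||_ /iinj]; do ?[exact: iQ]; exact.
by have /injfunPex[g] := ex_intro2 _ _ f ffun finj; exact: inj_card_le.
Qed.

(** By induction on [s]: if the part of [A] in the first member is not as large as [A], the part
    outside is, and the other members cover it. *)
Lemma infinite_set_bigcup_seq_card_le {T : Type} (A : set T) (s : seq (set T)) :
  infinite_set A -> (forall x, A x -> exists2 U, U \in s & U x) ->
  exists2 U, U \in s & A #<= A `&` U.
Proof.
elim: s A => [|U s IH] A Ainf As.
  by have [x /As[]] := infinite_setN0 Ainf.
have := Ainf; rewrite -(setUIDK A U).
case/infinite_setU_card_le; rewrite setUIDK => AU.
  by exists U => //; exact: mem_head.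
have AUinf : infinite_set (A `\` U).
  by move=> fin; exact/Ainf/(card_le_finite AU).
have [|V Vs AUV] := IH _ AUinf.
  move=> x [Ax nUx]; have [V] := As x Ax.
  by rewrite inE => /predU1P[->|Vs Vx]//; exists V.
exists V; first by rewrite inE Vs orbT.
apply: card_le_trans AU (card_le_trans AUV _).
by apply: subset_card_le => x [[]].
Qed.

(** * Chains of neighborhoods and hulls *)

Lemma notin_closureP {X : topologicalType} (A : set X) x :
  ~ closure A x <-> exists2 O, open_nbhs x O & A `&` O = set0.
Proof.
rewrite closureEonbhs; split=> [nAx|[O Ox AO] Ax].
  apply: contrapT => nO; apply: nAx => B O AB Ox; apply/set0P/eqP => BO.
  by apply: nO; exists O => //; apply: subsetI_eq0 BO.
by have := Ax A O (@subset_refl _ A) Ox; rewrite AO => -[].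
Qed.

Lemma openI_closure_eq0 {X : topologicalType} {A O : set X} :
  open O -> A `&` O = set0 -> closure A `&` O = set0.
Proof.
move=> Oop AO; rewrite -subset0 => x [Ax Ox].
by have : ~ closure A x by apply/notin_closureP; exists O.
Qed.

Lemma preimage_closure_sub {X Y : topologicalType} {f : X -> Y} (U : set Y) :
  continuous f -> closure (f @^-1` U) `<=` f @^-1` closure U.
Proof.
move=> /continuousP fc x fUx.
apply: contrapT => /notin_closureP[O [Oop Ofx] UO].
suff : ~ closure (f @^-1` U) x by [].
apply/notin_closureP; exists (f @^-1` O); first by split=> //; exact: fc.
by rewrite -preimage_setI UO preimage_set0.
Qed.

Section NbhsChains.
Context {X : topologicalType}.
Implicit Types (n : nat) (x y : X) (U V : nat -> set X).

Lemma nbhs_chain_step {n x U} i : nbhs_chain n x U -> 1 <= i < n ->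
  U i `<=` U i.+1.
Proof. by move=> [_ cU] /cU; apply: subset_trans; exact: subset_closure. Qed.

Lemma nbhs_chain_sub {n x U} i : nbhs_chain n x U -> 1 <= i <= n ->
  U i `<=` U n.
Proof.
move=> cU /andP[i1]; elim: n cU => [|n IH] cU; first by rewrite leqn0 => /eqP->.
rewrite leq_eqVlt ltnS => /predU1P[->//|iln].
apply: subset_trans (nbhs_chain_step n cU _); last first.
  by rewrite (leq_trans i1 iln) /=.
apply: IH iln; split=> j /andP[j1 jn].
  by apply: cU.1; rewrite j1 leqW.
by apply: cU.2; rewrite j1 leqW.
Qed.

Lemma nbhs_chainI {n x U V} : nbhs_chain n x U -> nbhs_chain n x V ->
  nbhs_chain n x (fun i => U i `&` V i).
Proof.
move=> [Uo Uc] [Vo Vc]; split=> i ilen.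
  exact: open_nbhsI (Uo _ _) (Vo _ _).
by apply: subset_trans (@closureI _ _ _) (setISS (Uc _ _) (Vc _ _)).
Qed.

Lemma nbhs_chain_cst n x (U : set X) : open_nbhs x U -> closed U ->
  nbhs_chain n x (fun=> U).
Proof. by move=> Ux Uc; split. Qed.

Definition theta_separated n x y :=
  exists2 U, nbhs_chain n x U & ~ closure (U n) y.

Lemma theta_separated_clopen n x y (U : set X) :
  open U -> closed U -> U x -> ~ U y -> theta_separated n x y.
Proof.
move=> Uo Uc Ux nUy; exists (fun=> U); first exact: nbhs_chain_cst.
by move=> /Uc.
Qed.

(** The complements of the [closure (U i)], in reverse order, form a chain around [y]; its last
    closure misses [x] because [U 1] is a neighborhood of [x]. *)
Lemma theta_separated_sym n x y : 1 <= n ->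
  theta_separated n x y -> theta_separated n y x.
Proof.
move=> n1 [U cU nUy].
have reflE j : 1 <= j <= n -> 1 <= n.+1 - j <= n.
  move=> /andP[j1 jn]; rewrite subn_gt0 ltnS jn /=.
  by rewrite leq_subLR addnC -addn1 leq_add2l.
have disj i : 1 <= i <= n -> closure (~` closure (U i)) `&` U i = set0.
  move=> iP; apply: openI_closure_eq0; first exact: (cU.1 i iP).1.
  rewrite setIC; apply/disjoints_subset; rewrite setCK.
  exact: subset_closure.
exists (fun j => ~` closure (U (n.+1 - j))); last first.
  rewrite subSnn => Ux; have : set0 x; last by [].
  by rewrite -(disj 1%N) //; split=> //; exact: (cU.1 1 _).2.
split=> j.
  move=> /reflE jP; split; first by apply: closed_openC; exact: closed_closure.
  by move=> /(closureS (nbhs_chain_sub _ cU jP)).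
move=> /andP[j1 jn].
have /disj disjj : 1 <= n.+1 - j <= n by apply: reflE; rewrite j1 ltnW.
rewrite subSS => z zj zj1.
have : set0 z; last by [].
rewrite -disjj; split=> //; rewrite subSn 1?ltnW //.
by apply: cU.2 zj1; rewrite subn_gt0 jn ltn_subrL j1 (ltn_trans j1 jn).
Qed.

End NbhsChains.

Lemma nbhs_chain_preimage {X Y : topologicalType} {f : X -> Y} {n x U} :
  continuous f -> nbhs_chain n (f x) U ->
  nbhs_chain n x (fun i => f @^-1` U i).
Proof.
move=> fc [Uo Uc]; split=> i iP.
  by have [Ui Uix] := Uo i iP; split=> //; exact: (iffLR (continuousP _) fc).
by apply: subset_trans (preimage_closure_sub _ fc) _ => z; exact: Uc.
Qed.

Lemma S_spaceP n (X : topologicalType) : 1 <= n ->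
  S_space n X <-> forall x y : X, x <> y -> theta_separated n x y.
Proof.
case: n => // n _; split=> XS x y /XS.
  move=> /contrapT[U [cU Uy]]; exists U => // yU.
  by have : set0 y by rewrite -Uy.
move=> [U cU nUy] /=; apply; exists U; split=> //.
by rewrite -subset0 => z [Uz zy]; rewrite zy in Uz.
Qed.

(** The index shifts by one because [U] itself becomes the last member of the chain. For [n = 1]
    both sides say that [U] is a neighborhood of [x]. *)
Lemma theta_interior_hull {X : topologicalType} n (U : set X) x : 1 <= n ->
  open U -> theta_interior n.-1 U x <-> hull n x U.
Proof.
case: n => // -[|n] _ Uo; rewrite /theta_interior /=.
  rewrite -[~ _]/((~` closure _) x) -interiorC setCK.
  split=> [Ux|[Ux _]]; last exact: open_nbhs_nbhs.
  have {}Ux : open_nbhs x U by split=> //; exact: interior_subset Ux.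
  split=> //; exists (fun=> U); split=> //.
  by split=> // i /andP[i1]; rewrite ltnNge i1.
split=> [/contrapT[V [[Vo Vc] VU]]|[Ux [V [[Vo Vc] VnU]]]]; last first.
  apply; exists V; split; last first.
    by apply/disjoints_subset; rewrite setCK -VnU; apply: Vc; rewrite ltnSn.
  by split=> i /andP[i1 iln]; [apply: Vo|apply: Vc]; rewrite i1 ltnW.
move/disjoints_subset: VU; rewrite setCK => VU.
have Ux : open_nbhs x U.
  by split=> //; apply/VU/subset_closure; have [|] := Vo n.+1; rewrite ?leqnn.
split=> //; exists (fun i => if i <= n.+1 then V i else U).
split; last by rewrite ltnn.
split=> i /andP[i1 iln].
  by case: leqP => // iln1; apply: Vo; rewrite i1.
rewrite -ltnS iln; case: (ltnP i n.+1) => [iln1|nli].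
  by apply: Vc; rewrite i1.
by have -> : i = n.+1 by apply/eqP; rewrite eqn_leq nli -ltnS iln.
Qed.

Lemma S_coverP {X : topologicalType} n (B : set X) gamma : 1 <= n ->
  S_cover n.-1 B gamma <->
  (forall U, gamma U -> open U) /\
  (forall x, B x -> exists2 U, gamma U & hull n x U).
Proof.
move=> n1; split=> -[go gB]; split=> // x /gB[U gU Ux]; exists U => //;
  exact/(theta_interior_hull n U x n1 (go U gU)).
Qed.

(** Both implications pass through this property; by [S_coverP] it concerns the
    [S_cover n.-1 setT]. *)
Definition hull_compact n (X : topologicalType) :=
  forall gamma : set (set X), (forall U, gamma U -> open U) ->
  (forall x, exists2 U, gamma U & hull n x U) ->
  exists s : seq (set X), (forall U, U \in s -> gamma U) /\
    (forall x, exists2 U, U \in s & U x).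

Lemma hull_mem {X : topologicalType} n (x : X) U : hull n x U -> U x.
Proof. by case=> -[]. Qed.

Lemma embedding_continuous {X Y : topologicalType} (f : X -> Y) :
  topological_embedding f -> continuous f.
Proof. by move=> [_ fo]; apply/continuousP => V Vo; apply/fo; exists V. Qed.

Lemma hull_compact_S_theta_closed n (X : topologicalType) :
  1 <= n -> S_space n X -> hull_compact n X -> S_theta_closed n X.
Proof.
move=> n1 XS Xc; split=> // Y f /(S_spaceP _ _ n1) YS /embedding_continuous fc.
apply/seteqP; split=> [y fy [U [[Uo _] Uy]]|y].
  have : set0 y; last by [].
  by rewrite -Uy; split=> //; apply: subset_closure; exact: (Uo 1 _).2.
apply: contraPP => nfy; apply.
(* For each [x], a chain separating [f x] from [y] pulls back to a chain in [X] whose last term is a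
   hull of [x] in [gamma]. *)
pose gamma (W : set X) := open W /\
  exists2 O : set Y, open_nbhs y O & closure O `&` f @` W = set0.
have [||s [sg sX]] := Xc gamma.
- by move=> W [].
- move=> x; have [|U cU nUy] := YS (f x) y.
    by move=> fxy; apply: nfy; exists x.
  have cfU := nbhs_chain_preimage fc cU.
  have nP : 1 <= n <= n by rewrite n1 leqnn.
  exists (f @^-1` U n); last first.
    by split; [exact: cfU.1|exists (fun i => f @^-1` U i)].
  split; first exact: (cfU.1 n nP).1.
  have [O Oy UO] := iffLR (notin_closureP _ _) nUy; exists O => //.
  rewrite setIC in UO.
  apply: subsetI_eq0 (openI_closure_eq0 (cU.1 n nP).1 UO) => //.
  by move=> _ [z Uz <-].
have [O Oy Os] : exists2 O : set Y, open_nbhs y O &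
    forall W, W \in s -> closure O `&` f @` W = set0.
  elim: s sg {sX} => [|W s IH] sg.
    by exists setT => //; exact: open_nbhsT.
  have [|O Oy Os] := IH; first by move=> V Vs; apply: sg; rewrite inE Vs orbT.
  have [_ [P Py PW]] := sg W (mem_head _ _).
  exists (O `&` P); first exact: open_nbhsI.
  move=> V; rewrite inE => /predU1P[->|/Os OV].
    by apply: subsetI_eq0 PW => //; apply: closureS; exact: subIsetr.
  by apply: subsetI_eq0 OV => //; apply: closureS; exact: subIsetl.
exists (fun=> O); split.
  by split=> // i /andP[i1]; rewrite ltnNge i1.
rewrite -subset0 => z [Oz [x _ fx]]; have [W Ws Wx] := sX x.
by rewrite -(Os W Ws); split=> //; exists x.
Qed.

(** * The one-point extension *)

(* [None] is the point to be added; [Some (x, Some k)] is isolated and tends to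
   [Some (x, None)], the copy of [x], as [k] grows. The trace of a neighborhood
   of [None] on the isolated points is large above the complement of some
   finite union of members of [gamma]. *)
Definition extension {X : topologicalType} (gamma : set (set X)) : Type :=
  option (X * option nat).

HB.instance Definition _ (X : topologicalType) (gamma : set (set X)) :=
  Choice.on (extension gamma).

Section Extension.
Context {X : topologicalType} {gamma : set (set X)}.
Local Notation Y := (extension gamma).

Definition embed (x : X) : Y := Some (x, None).
Definition isolate (x : X) (k : nat) : Y := Some (x, Some k).

Definition open_extension (O : set Y) : Prop :=
  [/\ open (embed @^-1` O),
      forall x, O (embed x) -> \forall k \near \oo, O (isolate x k)
    & O None -> exists2 s : seq (set X), forall U, U \in s -> gamma U &
        forall x, (forall U, U \in s -> ~ U x) ->
          \forall k \near \oo, O (isolate x k)].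

Lemma open_extensionT : open_extension setT.
Proof.
split; first exact: openT.
  by move=> x _; near=> k.
by move=> _; exists [::] => // x _; near=> k.
Unshelve. all: by end_near. Qed.

Lemma open_extensionI : setI_closed open_extension.
Proof.
move=> O P [Oo Ox ON] [Po Px PN]; split; first exact: openI.
  by move=> x [/Ox Oxk /Px Pxk]; exact: filterI.
move=> [/ON[s sg sO] /PN[t tg tP]]; exists (s ++ t) => [U|x stx].
  by rewrite mem_cat => /orP[/sg|/tg].
apply: filterI.
  by apply: sO => U Us; apply: stx; rewrite mem_cat Us.
by apply: tP => U Ut; apply: stx; rewrite mem_cat Ut orbT.
Qed.

Lemma open_extension_bigcup (I : Type) (O : I -> set Y) :
  (forall i, open_extension (O i)) -> open_extension (\bigcup_i O i).
Proof.
move=> Oo; split.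
- by rewrite preimage_bigcup; apply: bigcup_open => i _; have [] := Oo i.
- move=> x [i _ Oix]; have [_ /(_ _ Oix) + _] := Oo i.
  by apply: filterS => k; exists i.
- move=> [i _ OiN]; have [_ _ /(_ OiN)[s sg sO]] := Oo i; exists s => // x sx.
  by apply: filterS (sO x sx) => k; exists i.
Qed.

End Extension.

HB.instance Definition _ (X : topologicalType) (gamma : set (set X)) :=
  isOpenTopological.Build (extension gamma)
    open_extensionT open_extensionI open_extension_bigcup.

Section ExtensionTopology.
Context {X : topologicalType} {gamma : set (set X)}.
Local Notation Y := (extension gamma).

Lemma openE_extension (O : set Y) : open O = open_extension O.
Proof. by []. Qed.

Definition tube (U : set X) : set Y :=
  fun z => if z is Some (x, _) then U x else False.

Lemma open_tube (U : set X) : open U -> open (tube U).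
Proof. by move=> Uo; rewrite openE_extension; split=> // x Ux; near=> k.
Unshelve. all: by end_near. Qed.

Lemma topological_embedding_embed : topological_embedding (embed : X -> Y).
Proof.
split=> [x y [//]|U]; split=> [Uo|[V [Vo <-]]]; last by case: Vo.
by exists (tube U); split=> //; exact: open_tube.
Qed.

(** [None] stays out of the closure: together with the isolated points above the complement of [V]
    it forms an open set that misses [tube U]. *)
Lemma closure_tube (U V : set X) : gamma V -> U `<=` V ->
  closure (tube U) `<=` tube (closure U).
Proof.
move=> gV UV [[x k]|] Uz.
  apply: contrapT => nUx; move: Uz; apply/notin_closureP.
  exists (tube (~` closure U)).
    split=> //; apply: open_tube; apply: closed_openC; exact: closed_closure.
  rewrite -subset0 => -[[y j]|[]//] [Uy]; apply; exact: subset_closure.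
move: Uz; apply/notin_closureP.
exists [set z : Y | if z is Some (y, j) then j != None /\ ~ V y else True].
  split=> //; rewrite openE_extension; split=> /=.
  - rewrite (_ : _ @^-1` _ = set0); first exact: open0.
    by rewrite -subset0 => y [].
  - by move=> y [].
  - move=> _; exists [:: V] => [W|y]; first by rewrite inE => /eqP->.
    by move=> /(_ _ (mem_head _ _)) nVy; near=> k.
by rewrite -subset0 => -[[y j]|[]//] [/= /UV Vy []].
Unshelve. all: by end_near. Qed.

Lemma isolate_clopen x k :
  open [set (isolate x k : Y)] /\ closed [set (isolate x k : Y)].
Proof.
split.
  rewrite openE_extension; split=> [|//|//].
  rewrite (_ : _ @^-1` _ = set0); first exact: open0.
  by rewrite -subset0.
rewrite -openC openE_extension.
(* Each sequence of isolated points eventually leaves the singleton, so the empty subfamily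
   witnesses openness at [None]. *)
have far y : \forall j \near \oo, (~` [set (isolate x k : Y)]) (isolate y j).
  near=> j => -[_ jk]; suff : (k < j)%N by rewrite jk ltnn.
  by near: j; exact: nbhs_infty_gt.
split=> // [|_]; last by exists [::].
rewrite (_ : _ @^-1` _ = setT); first exact: openT.
by apply/seteqP; split.
Unshelve. all: by end_near. Qed.

Lemma nbhs_chain_tube n (x : X) U V : nbhs_chain n x U -> gamma V ->
  U n `<=` V -> nbhs_chain n (embed x) (fun i => tube (U i)).
Proof.
move=> cU gV UnV; split=> i iP.
  by have [Uo Ux] := cU.1 i iP; split=> //; exact: open_tube.
apply: subset_trans (closure_tube _ V gV _) _.
  apply: subset_trans UnV; apply: nbhs_chain_sub cU _.
  by case/andP: iP => -> /ltnW.
by move=> [[y j]|//]; exact: cU.2.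
Qed.

Lemma S_space_extension n : 1 <= n -> S_space n X ->
  (forall x, exists2 U, gamma U & hull n x U) -> S_space n Y.
Proof.
move=> n1 /(S_spaceP _ _ n1) XS gX; apply/S_spaceP => // y z yz.
have nP : 1 <= n <= n by rewrite n1 leqnn.
have sepN x : theta_separated n (embed x) (None : Y).
  have [V gV [_ [U [cU UnV]]]] := gX x.
  exists (fun i => tube (U i)).
    by apply: nbhs_chain_tube cU gV _; rewrite UnV.
  by move=> /(closure_tube _ _ gV); rewrite UnV => /(_ (@subset_refl _ _)).
have sepE x x' : x <> x' -> theta_separated n (embed x : Y) (embed x').
  move=> /XS[W cW nWx'].
  (* Intersecting with a hull chain puts the last term inside a member of [gamma], as [closure_tube]
     requires. *)
  have [V gV [_ [U [cU UnV]]]] := gX x; have cWU := nbhs_chainI cW cU.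
  have WUV : W n `&` U n `<=` V by rewrite UnV; exact: subIsetr.
  exists (fun i => tube (W i `&` U i)); first exact: nbhs_chain_tube cWU gV WUV.
  by move=> /(closure_tube _ _ gV WUV) /closureI[].
have sepI x k (w : Y) : w <> isolate x k -> theta_separated n w (isolate x k).
  move=> wxk; have [oxk cxk] := isolate_clopen x k.
  apply: (theta_separated_clopen _ _ _ (~` [set (isolate x k : Y)])) => //.
  - exact: closed_openC.
  - exact: open_closedC.
  - by apply.
case: y z yz => [[x [k|]]|] [[x' [k'|]]|] yz; try exact: sepI.
- by apply: theta_separated_sym => //; apply: sepI => /esym.
- by apply: theta_separated_sym => //; apply: sepI => /esym.
- by apply: sepE => xx'; apply: yz; rewrite xx'.
- exact: sepN.
- by apply: theta_separated_sym => //; exact: sepN.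
- by [].
Qed.

End ExtensionTopology.

Lemma S_theta_closed_hull_compact n (X : topologicalType) :
  1 <= n -> S_theta_closed n X -> hull_compact n X.
Proof.
move=> n1 [XS Xc] gamma go gX.
have : ~ theta_closure 1 (range embed) (None : extension gamma).
  have YS := S_space_extension n n1 XS gX.
  by rewrite -(Xc _ _ YS topological_embedding_embed) => -[].
move=> /contrapT[U [[/(_ 1 isT)[Uo UN] _] Udisj]].
(* Above a point [x] outside every member of [s], [U 1] contains almost all isolated points, so
   [embed x] lies in its closure, against [Udisj]. *)
have [_ _ /(_ UN)[s sg sU]] := Uo; exists s; split=> // x.
apply: contrapT => nsx; have : set0 (embed x : extension gamma); last by [].
rewrite -Udisj; split; last by exists x.
apply: contrapT => /notin_closureP[O [[_ Ox _] /Ox Oxk] UO].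
have Uxk : \forall k \near \oo, U 1 (isolate x k).
  by apply: sU => V Vs Vx; apply: nsx; exists V.
have [k [Ok Uk]] := filter_ex (filterI Oxk Uxk).
by have : set0 (isolate x k : extension gamma) by rewrite -UO.
Qed.

(** * Convergence to complete accumulation points *)

Lemma hull_compact_theta_converges n (X : topologicalType) (A : set X) :
  1 <= n -> hull_compact n X -> infinite_set A ->
  theta_converges n A (complete_accumulation_points n A).
Proof.
move=> n1 Xc Ainf gamma /(S_coverP _ _ _ n1)[go gB].
(* A point that is not a complete accumulation point of [A] has a hull in [small]. *)
pose small := [set U : set X | open U /\ ~ (A `&` U #= A)].
have [||s [sg sX]] := Xc (gamma `|` small).
- by move=> U [/go|[]].
- move=> x; have [Bx|nBx] := pselect (complete_accumulation_points n A x).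
    by have [U gU Ux] := gB x Bx; exists U => //; left.
  have [U Ux AU] : exists2 U, hull n x U & ~ (A `&` U #= A).
    apply: contrapT => nU; apply: nBx => U Ux; apply: contrapT => AU.
    by apply: nU; exists U.
  by exists U => //; right; split=> //; case: Ux => -[].
exists ([set` s] `&` gamma); split; first exact: finite_setIl.
  exact: subIsetr.
(* If [D] were as large as [A], so would be its part in some member of [s]; but [D] misses the
   members from [gamma], and those in [small] meet [A] in too small a set. *)
rewrite card_le_setD /=; apply/negP => AD; set D := A `\` _ in AD.
have Dinf : infinite_set D by move=> Dfin; exact/Ainf/(card_le_finite AD).
have [|U Us DU] := infinite_set_bigcup_seq_card_le D s Dinf.
  by move=> x _; exact: sX.
have [gU|[_]] := sg U Us.
  have DU0 : D `&` U = set0.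
    by rewrite -subset0 => x [[_ nsx] Ux]; apply: nsx; exists U.
  by apply: Dinf; apply: card_le_finite DU _; rewrite DU0.
case; rewrite card_eq_le subset_card_le; last exact: subIsetl.
apply: card_le_trans AD (card_le_trans DU (subset_card_le _)).
by move=> x [[]].
Qed.

Lemma theta_converges_hull_compact n (X : topologicalType) : 1 <= n ->
  (forall A : set X, infinite_set A ->
     theta_converges n A (complete_accumulation_points n A)) ->
  hull_compact n X.
Proof.
move=> n1 Xconv gamma go gX.
pose covered (A : set X) := exists s : seq (set X),
  (forall U, U \in s -> gamma U) /\ (forall x, A x -> exists2 U, U \in s & U x).
suff [s [sg sX]] : covered setT by exists s; split=> // x; exact: sX.
apply: contrapT => nX.
have [|A nA Amin] := card_min (F := ~` covered); first by exists setT.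
have [Afin|Ainf] := pselect (finite_set A).
  move: Afin => /(@finite_seqP X)[t AE]; apply: nA; rewrite AE => {A AE Amin}.
  elim: t => [|x t [s [sg st]]]; first by exists [::].
  have [U gU /hull_mem Ux] := gX x; exists (U :: s); split=> [V|y /=].
    by rewrite inE => /predU1P[->|/sg].
  rewrite inE => /predU1P[->|/st[V Vs Vy]].
    by exists U => //; exact: mem_head.
  by exists V => //; rewrite inE Vs orbT.
have [|d [/(@finite_seqP (set X))[t dE] dg /andP[_ AD]]] := Xconv A Ainf gamma.
  by apply/S_coverP => //; split=> // x _; exact: gX.
(* The part left over is strictly smaller than [A], so minimality makes it covered. *)
subst d; have [s [sg sD]] : covered (A `\` \bigcup_(U in [set` t]) U).
  by apply: contrapT => /Amin; apply/negP.
apply: nA; exists (s ++ t); split=> [U|x Ax].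
  by rewrite mem_cat => /orP[/sg|/dg].
have [[U Ut Ux]|ntx] := pselect ((\bigcup_(U in [set` t]) U) x).
  by exists U => //; rewrite mem_cat Ut orbT.
have [|U Us Ux] := sD x; first by split.
by exists U => //; rewrite mem_cat Us.
Qed.

Theorem theorem4p6 (n : nat) (n_ge1 : (1 <= n)%N)
    (X : topologicalType) (XS : S_space n X) :
  S_theta_closed n X <->
  (forall A : set X, infinite_set A ->
     theta_converges n A (complete_accumulation_points n A)).
Proof.
split=> [/(S_theta_closed_hull_compact _ _ n_ge1) Xc A|Xconv].
  exact: hull_compact_theta_converges.
exact/hull_compact_S_theta_closed/theta_converges_hull_compact.
Qed.
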